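(* Let $(\mathcal X,\mathcal B,\pi)$ be a measure space with $\pi$ $\sigma$-finite, let $r:\mathcal X\to\mathbb R$ be measurable, let $\{\varepsilon(x):x\in\mathcal X\}$ be a real-valued random field and $\varepsilon_1,\varepsilon_2,\dots$ i.i.d. copies of it, independent of all sampled points, and fix an integer $K\ge 2$. Let $p_0\in\mathcal P_\pi$ satisfy $\int p_0|\log p_0|\,d\pi<\infty$. Define recursively, for $t\in\mathbb N$, $p_{t+1}$ as a maximizer over $p\in\mathcal P_\pi$ of $$\mathcal L(p;p_t,K,0):=\mathbb E\bigl[\log p(\widehat X)\bigr],$$ where $X_1,\dots,X_K$ are i.i.d. with density $p_t$ and $\widehat X=X_I$ is the Plackett–Luce curated sample described in the context. Then for every $t\in\mathbb N$, $\mathcal L(p;p_t,K,0)=\mathbb E_{X\sim p_t}\bigl[\log p(X)\,H^K_{p_t}(X)\bigr]$, this functional has a unique maximizer over $p\in\mathcal P_\pi$, and the maximizer is $$p_{t+1}(x)=p_t(x)\,H^K_{p_t}(x),\qquad x\in\mathcal X.$$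
   Context: $\mathcal P_\pi$ is the set of probability measures on $(\mathcal X,\mathcal B)$ absolutely continuous w.r.t. $\pi$, identified with their densities. Plackett–Luce curation: given $X_1,\dots,X_K$ i.i.d. with density $p$ and noise copies $\varepsilon_1,\dots,\varepsilon_K$ (independent of the $X$'s), set $\tilde w_k=e^{r(X_k)+\varepsilon_k(X_k)}$ and draw an index $I\in\{1,\dots,K\}$ with $\mathbb P(I=k\mid X_{1:K},\varepsilon_{1:K})=\tilde w_k/\sum_{i=1}^K\tilde w_i$; the curated sample is $\widehat X=X_I$. The choice kernel is $$H^K_p(x):=\mathbb E\Bigl[K\,\frac{e^{r(x)+\varepsilon(x)}}{e^{r(x)+\varepsilon(x)}+\sum_{k=1}^{K-1}e^{r(X_k)+\varepsilon_k(X_k)}}\Bigr],$$ with $X_1,\dots,X_{K-1}$ i.i.d. with density $p$ and $\varepsilon,\varepsilon_1,\dots,\varepsilon_{K-1}$ i.i.d. copies of the noise field, all independent. *)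

(* Defs.v *)
From HB Require Import structures.
From mathcomp Require Import all_boot all_order all_algebra.
From mathcomp Require Import all_classical all_reals all_analysis.
Set Implicit Arguments. Unset Strict Implicit. Unset Printing Implicit Defensive.
Import Order.TTheory GRing.Theory Num.Theory.
Local Open Scope classical_set_scope.
Local Open Scope ring_scope.

(* Plackett--Luce curation.
   - The sample space is [T] (measurable), with reference measure [pi].
   - The noise random field is modelled by a probability space [(N, Q)] of
     noise realizations together with an evaluation map [eps : N -> T -> R]
     (eps n x = value of the field at x in realization n).  I.i.d. copies of
     the field = independent draws n_1, n_2, ... from Q.
   - A density is a measurable nonnegative [p : T -> R] with integral 1. *)

Section PL.
Variables (R : realType) (d dN : measure_display).
Variables (T : measurableType d) (N : measurableType dN).
Variables (pi : {measure set T -> \bar R}) (Q : probability N R).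
Variables (r : T -> R) (eps : N -> T -> R).

Definition is_density (p : T -> R) : Prop :=
  [/\ measurable_fun setT p, (forall x, 0 <= p x) & (\int[pi]_x (p x)%:E = 1)%E].

Definition elog (y : R) : \bar R := if 0 < y then (ln y)%:E else -oo%E.

Definition plw (n : N) (x : T) : R := expR (r x + eps n x).

(* Expectation of a nonnegative functional F of k i.i.d. pairs
   (X_j, noise_j), X_j with density p w.r.t. pi, noise_j ~ Q, all independent
   (iterated integral; equal to the product-measure integral by Tonelli). *)
Fixpoint iidE (p : T -> R) (k : nat) (F : seq (T * N) -> \bar R) : \bar R :=
  match k with
  | 0 => F [::]
  | k'.+1 => (\int[pi]_x ((p x)%:E *
               \int[Q]_n iidE p k' (fun s => F ((x, n) :: s))))%E
  end.

Definition HK (p : T -> R) (K : nat) (x : T) : R :=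
  fine (\int[Q]_n0 iidE p K.-1 (fun s =>
     (K%:R * plw n0 x / (plw n0 x + \sum_(z <- s) plw z.2 z.1))%:E))%E.

(* E[g(Xhat)] for nonnegative g, where Xhat = X_I is the curated sample:
   given (X_k, eps_k)_{k<=K}, I = k with probability w_k / sum_i w_i. *)
Definition curE (p : T -> R) (K : nat) (g : T -> \bar R) : \bar R :=
  iidE p K (fun s => (\sum_(z <- s)
     ((plw z.2 z.1 / \sum_(u <- s) plw u.2 u.1)%:E * g z.1))%E).

Definition Lcur (q p : T -> R) (K : nat) : \bar R :=
  (curE p K (fun x => maxe (elog (q x)) 0) -
   curE p K (fun x => maxe (- elog (q x)) 0))%E.

Definition is_maximizer (p : T -> R) (K : nat) (q : T -> R) : Prop :=
  is_density q /\ forall q', is_density q' -> (Lcur q' p K <= Lcur q p K)%E.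

End PL.

(* Main.v *)
(* Exchangeability of the K samples turns E[g(Xhat)] into K times the
   contribution of one distinguished sample, i.e. int p g H, for every g >= 0;
   hence q |-> L(q; p) is the cross entropy int pH log q.  Taking g = 1 shows
   that pH is a density, so Gibbs' inequality
   a log q <= a log a + q - a (strict for q <> a) makes it the maximizer,
   unique as soon as int pH |log (pH)| is finite.  Finiteness propagates along
   the iteration because 0 <= H <= K and h |log h| is bounded on [0, K]. *)
Require Import Defs.
From HB Require Import structures.
From mathcomp Require Import all_boot all_order all_algebra.
From mathcomp Require Import all_classical all_reals all_analysis.
From mathcomp Require Import measurable_realfun ring lra.
Import Order.TTheory GRing.Theory Num.Theory.
Local Open Scope classical_set_scope.
Local Open Scope ring_scope.

(** * Sigma-finiteness of the product of [pi] with the noise law *)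

Section ProductWithProbability.
Context {R : realType} {d dN : measure_display}.
Context {T : measurableType d} {N : measurableType dN}.
Context (pi : {sigma_finite_measure set T -> \bar R}) (Q : probability N R).

Lemma product_measure1_sigma_finite : sigma_finite setT (pi \x Q)%E.
Proof.
have [F TF Ff] := sigma_finiteT pi.
exists (fun n => F n `*` setT).
  by rewrite -setXTT TF setX_bigcupl.
move=> n; have [mF Foo] := Ff n; split; first exact: measurableX.
rewrite product_measure1E// -[ltLHS]/(pi (F n) * Q setT)%E.
by rewrite probability_setT mule1.
Qed.

(* The sigma-finite instance declared by the library on [\x] is shadowed by the
   one for products of two subprobabilities. *)
Definition prodM : {sigma_finite_measure set (T * N)%type -> \bar R} :=
  HB.pack_for {sigma_finite_measure set (T * N)%type -> \bar R} (pi \x Q)%E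
    (Measure_isSigmaFinite.Build _ _ _ (pi \x Q)%E
       product_measure1_sigma_finite).

End ProductWithProbability.

(** * Expectation over one pair of a sample and its noise *)

Section WeightedExpectation.
Context {R : realType} {d dN : measure_display}.
Context {T : measurableType d} {N : measurableType dN}.
Context (pi : {sigma_finite_measure set T -> \bar R}) (Q : probability N R).
Context (p : T -> R).
Hypothesis pd : is_density pi p.

Local Notation Z := (T * N)%type.

(** This is one layer of [iidE]: [iidES] holds by conversion, and facts about [k] draws follow by
    induction with one [pairE] per step. *)
Definition pairE (f : Z -> \bar R) : \bar R :=
  (\int[pi]_x ((p x)%:E * \int[Q]_n f (x, n)))%E.

Let mp : measurable_fun setT p. Proof. by case: pd. Qed.
Let p0 x : 0 <= p x. Proof. by case: pd. Qed.

Let mpz {d'} {S : measurableType d'} :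
  measurable_fun setT (EFin \o (fun z : S * Z => p z.2.1)).
Proof.
apply/measurable_EFinP; apply: (measurableT_comp mp).
exact: (measurableT_comp measurable_fst measurable_snd).
Qed.

Let mpz1 : measurable_fun setT (EFin \o (fun z : Z => p z.1)).
Proof. by apply/measurable_EFinP; apply: (measurableT_comp mp). Qed.

(** By Tonelli, since [p] is constant in the noise variable. As a single integral against the
    product measure, [pairE] inherits monotonicity, additivity and exchange of integrals. *)
Lemma pairEE (f : Z -> \bar R) : measurable_fun setT f ->
  (forall z, 0 <= f z)%E ->
  pairE f = (\int[prodM pi Q]_z ((p z.1)%:E * f z))%E.
Proof.
move=> mf f0.
have mpf : measurable_fun setT (fun z : Z => (p z.1)%:E * f z)%E.
  exact: emeasurable_funM.
rewrite [RHS](fubini_tonelli1 (m1 := pi) (m2 := Q) _ mpf); last first.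
  by move=> z; rewrite mule_ge0// lee_fin.
apply: eq_integral => x _; rewrite /fubini_F /= ge0_integralZl//.
- exact: (measurableT_comp mf).
- by rewrite lee_fin.
Qed.

Lemma eq_pairE (f g : Z -> \bar R) : (forall z, f z = g z) ->
  pairE f = pairE g.
Proof. by move=> fg; congr pairE; apply/funext. Qed.

Lemma pairE_ge0 (f : Z -> \bar R) : (forall z, 0 <= f z)%E -> (0 <= pairE f)%E.
Proof.
move=> f0; apply: integral_ge0 => x _; rewrite mule_ge0 ?lee_fin//.
exact: integral_ge0.
Qed.

Lemma le_pairE (f g : Z -> \bar R) :
  measurable_fun setT f -> measurable_fun setT g ->
  (forall z, 0 <= f z)%E -> (forall z, f z <= g z)%E -> (pairE f <= pairE g)%E.
Proof.
move=> mf mg f0 fg.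
have g0 z : (0 <= g z)%E by exact: le_trans (fg z).
rewrite !pairEE//; apply: ge0_le_integral => //.
- by move=> z _; rewrite mule_ge0// lee_fin.
- exact: emeasurable_funM.
- exact: emeasurable_funM.
- by move=> z _; rewrite lee_wpmul2l// lee_fin.
Qed.

Lemma pairED (f g : Z -> \bar R) :
  measurable_fun setT f -> measurable_fun setT g ->
  (forall z, 0 <= f z)%E -> (forall z, 0 <= g z)%E ->
  pairE (fun z => f z + g z)%E = (pairE f + pairE g)%E.
Proof.
move=> mf mg f0 g0.
rewrite !pairEE//; last 2 first.
- exact: emeasurable_funD.
- by move=> z; rewrite adde_ge0.
rewrite -ge0_integralD//.
- by apply: eq_integral => z _; rewrite ge0_muleDr.
- by move=> z _; rewrite mule_ge0// lee_fin.
- exact: emeasurable_funM.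
- by move=> z _; rewrite mule_ge0// lee_fin.
- exact: emeasurable_funM.
Qed.

Lemma pairEZl (k : \bar R) (f : Z -> \bar R) : measurable_fun setT f ->
  (forall z, 0 <= f z)%E -> (0 <= k)%E ->
  pairE (fun z => k * f z)%E = (k * pairE f)%E.
Proof.
move=> mf f0 k0.
rewrite !pairEE//; last 2 first.
- exact: measurable_funeM.
- by move=> z; rewrite mule_ge0.
rewrite -ge0_integralZl//.
- by apply: eq_integral => z _; rewrite muleCA.
- exact: emeasurable_funM.
- by move=> z _; rewrite mule_ge0// lee_fin.
Qed.

Lemma pairE_cst (k : R) : pairE (fun=> k%:E) = k%:E.
Proof.
rewrite /pairE; under eq_integral do
  rewrite integral_cst//= probability_setT mule1 muleC.
rewrite integralZl//.
  by case: pd => _ _ ->; rewrite mule1.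
apply/integrableP; split; first exact/measurable_EFinP.
under eq_integral do rewrite gee0_abs ?lee_fin//.
by case: pd => _ _ ->; rewrite ltry.
Qed.

Lemma measurable_pairE {d'} {S : measurableType d'} (f : S * Z -> \bar R) :
  measurable_fun setT f -> (forall z, 0 <= f z)%E ->
  measurable_fun setT (fun s => pairE (fun z => f (s, z))).
Proof.
move=> mf f0.
have -> : (fun s => pairE (fun z => f (s, z))) =
    fubini_F (prodM pi Q) (fun sz : S * Z => (p sz.2.1)%:E * f sz)%E.
  apply/funext => s; rewrite pairEE//.
  exact: (measurableT_comp mf (pair1_measurable s)).
apply: measurable_fun_fubini_tonelli_F.
- exact: (emeasurable_funM mpz mf).
- by move=> z; rewrite mule_ge0// lee_fin.
Qed.

Lemma pairE_swap (f : Z * Z -> \bar R) :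
  measurable_fun setT f -> (forall z, 0 <= f z)%E ->
  pairE (fun y => pairE (fun z => f (y, z))) =
  pairE (fun z => pairE (fun y => f (y, z))).
Proof.
move=> mf f0.
have mf' : measurable_fun setT (fun z : Z * Z => f (z.2, z.1)).
  by apply: (measurableT_comp mf); exact: measurable_fun_pair.
have msec y : measurable_fun setT (fun z => f (y, z)).
  exact: (measurableT_comp mf (pair1_measurable y)).
have msec' z : measurable_fun setT (fun y => f (y, z)).
  exact: (measurableT_comp mf (pair2_measurable z)).
rewrite (pairEE _ (@measurable_pairE _ Z f mf f0)); last first.
  by move=> y; exact: pairE_ge0.
have f0' (z : Z * Z) : (0 <= f (z.2, z.1))%E by [].
rewrite [RHS](pairEE _ (@measurable_pairE _ Z _ mf' f0')); last first.
  by move=> y; exact: pairE_ge0.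
(* Both density weights go inside, so that the two orders of drawing become the two iterated
   integrals of one nonnegative function. *)
pose F := (fun yz : Z * Z => (p yz.1.1)%:E * ((p yz.2.1)%:E * f yz))%E.
have mF : measurable_fun setT F.
  exact: (emeasurable_funM (measurableT_comp mpz1 measurable_fst)
    (emeasurable_funM mpz mf)).
have F0 yz : (0 <= F yz)%E by rewrite /F !mule_ge0// lee_fin.
transitivity (\int[prodM pi Q]_y \int[prodM pi Q]_z F (y, z))%E.
  apply: eq_integral => y _; rewrite (pairEE _ (msec y))// -ge0_integralZl//.
  - exact: (emeasurable_funM mpz1 (msec y)).
  - by move=> z _; rewrite mule_ge0// lee_fin.
  - by rewrite lee_fin.
rewrite (fubini_tonelli _ mF F0); apply: eq_integral => z _.
rewrite (pairEE _ (msec' z))// -ge0_integralZl//.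
- by apply: eq_integral => y _; rewrite /F /= muleCA.
- exact: (emeasurable_funM mpz1 (msec' z)).
- by move=> y _; rewrite mule_ge0// lee_fin.
- by rewrite lee_fin.
Qed.

End WeightedExpectation.

(** * Expectations over several i.i.d. draws *)

Section Curation.
Context {R : realType} {d dN : measure_display}.
Context {T : measurableType d} {N : measurableType dN}.
Context (pi : {sigma_finite_measure set T -> \bar R}) (Q : probability N R).
Context (r : T -> R) (eps : N -> T -> R) (p : T -> R).
Hypothesis mr : measurable_fun setT r.
Hypothesis meps : measurable_fun setT (fun z : N * T => eps z.1 z.2).
Hypothesis pd : is_density pi p.

Local Notation Z := (T * N)%type.

Let mp : measurable_fun setT p. Proof. by case: pd. Qed.
Let p0 x : 0 <= p x. Proof. by case: pd. Qed.

Let w (z : Z) : R := plw r eps z.2 z.1.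

Let w_gt0 z : 0 < w z. Proof. exact: expR_gt0. Qed.

Let w_ge0 z : 0 <= w z. Proof. exact: ltW. Qed.

Let sumw_ge0 (s : seq Z) : 0 <= \sum_(z <- s) w z.
Proof. exact: sumr_ge0. Qed.

Let mw : measurable_fun setT w.
Proof.
apply: (measurableT_comp (@measurable_expR R)).
apply: measurable_funD; first exact: (measurableT_comp mr).
apply: (measurableT_comp (g := fun z : Z => (z.2, z.1)) meps).
exact: measurable_fun_pair.
Qed.

Let iid := iidE pi Q p.

Lemma iidES k F :
  iid k.+1 F = pairE pi Q p (fun z => iid k (fun s => F (z :: s))).
Proof. by []. Qed.

(** Only lists of length [k] are ever evaluated; [curE_cst1] relies on this to exclude the empty
    list. *)
Lemma eq_iidE k F G : (forall s, size s = k -> F s = G s) ->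
  iid k F = iid k G.
Proof.
elim: k F G => [|k IH] F G FG; first exact: FG.
by rewrite !iidES; apply: eq_pairE => z; apply: IH => s sk; rewrite FG//= sk.
Qed.

Lemma iidE_cst k (c : R) : iid k (fun=> c%:E) = c%:E.
Proof.
elim: k => [//|k IH].
by rewrite iidES (eq_pairE _ _ _ _ (fun=> c%:E))// pairE_cst.
Qed.

(* The absolute value makes [iidV k] nonnegative, hence amenable to Tonelli,
   on the whole real line; only nonnegative arguments matter. *)
Definition iidV k (c : R) : \bar R :=
  iid k (fun s => (`|c + \sum_(z <- s) w z|^-1)%:E).

Lemma iidVS k c : iidV k.+1 c = pairE pi Q p (fun z => iidV k (c + w z)).
Proof.
rewrite /iidV iidES; apply: eq_pairE => z; apply: eq_iidE => s _.
by rewrite big_cons addrA.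
Qed.

Lemma iidV_ge0 k c : (0 <= iidV k c)%E.
Proof.
elim: k c => [|k IH] c; first by rewrite /iidV lee_fin invr_ge0.
by rewrite iidVS; exact: (pairE_ge0 pi Q p pd).
Qed.

Lemma measurable_iidV k : measurable_fun setT (iidV k).
Proof.
elim: k => [|k IH].
  (* As a real power, the inverse is measurable on the whole line; at [0] both conventions give
     [0]. *)
  rewrite (_ : iidV 0 = EFin \o (fun c => powR `|c| (- 1))); last first.
    by apply/funext => c; rewrite /iidV /iid /= big_nil addr0 powR_inv1.
  apply/measurable_EFinP.
  have mn : measurable_fun setT (fun c : R => `|c|) by exact: normr_measurable.
  have mi : measurable_fun setT (fun c : R => powR c (- 1)).
    exact: measurable_powR.
  exact: (measurableT_comp mi mn).
rewrite (_ : iidV k.+1 = fun c => pairE pi Q p (fun z => iidV k (c + w z))).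
  apply: (measurable_pairE pi Q p pd
    (fun cz : R * Z => iidV k (cz.1 + w cz.2))).
    apply: (measurableT_comp IH); apply: measurable_funD => //.
    exact: (measurableT_comp mw).
  by move=> z; exact: iidV_ge0.
by apply/funext => c; rewrite iidVS.
Qed.

Lemma measurable_iidV_shift k c :
  measurable_fun setT (fun z => iidV k (c + w z)).
Proof.
by apply: (measurableT_comp (measurable_iidV k)); exact: measurable_funD.
Qed.

(** Further positive weights only enlarge the denominator, and averaging a constant returns it. *)
Lemma iidV_le k c : 0 < c -> (iidV k c <= (c^-1)%:E)%E.
Proof.
elim: k c => [|k IH] c c0.
  by rewrite /iidV /iid /= big_nil addr0 gtr0_norm.
rewrite iidVS -[leRHS](pairE_cst pi Q p pd); apply: le_pairE => //.
- exact: measurable_iidV_shift.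
- by move=> z; exact: iidV_ge0.
- move=> z; apply: (le_trans (IH _ _)); first by rewrite addr_gt0.
  by rewrite lee_fin lef_pV2 ?posrE ?addr_gt0// lerDl.
Qed.

(** For [c >= 0] the denominator is nonnegative and the absolute value in [iidV] disappears; this
    connects the integrand of [HK] with [iidV]. *)
Lemma iidVZl k (b c : R) : 0 <= b -> 0 <= c ->
  iid k (fun s => (b / (c + \sum_(z <- s) w z))%:E) = (b%:E * iidV k c)%E.
Proof.
elim: k c => [|k IH] c b0 c0.
  by rewrite /iidV /iid /= big_nil addr0 ger0_norm// EFinM.
rewrite iidVS -(pairEZl pi Q p pd _ _ (measurable_iidV_shift k c)); first last.
- by rewrite lee_fin.
- by move=> z; exact: iidV_ge0.
rewrite iidES; apply: eq_pairE => z; rewrite -IH ?addr_ge0//.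
by apply: eq_iidE => s _; rewrite big_cons addrA.
Qed.

(** * Reduction of the curated expectation to one distinguished sample *)

Section Ratio.
Context (g : T -> \bar R).
Hypothesis mg : measurable_fun setT g.
Hypothesis g0 : forall x, (0 <= g x)%E.

Let wg (z : Z) : \bar R := ((w z)%:E * g z.1)%E.

Let wg_ge0 z : (0 <= wg z)%E.
Proof. by rewrite /wg mule_ge0// lee_fin. Qed.

Let mwg : measurable_fun setT wg.
Proof.
apply: emeasurable_funM; first exact/measurable_EFinP.
exact: (measurableT_comp mg).
Qed.

(** For [c >= 0], the expectation of [w z * g z.1 / (c + w z + W)], with [W] the total weight of [k]
    further draws: the share of one distinguished sample. *)
Definition headE k (c : R) : \bar R :=
  pairE pi Q p (fun z => wg z * iidV k (c + w z))%E.

Lemma headE_ge0 k c : (0 <= headE k c)%E.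
Proof. by apply: (pairE_ge0 pi Q p pd) => z; rewrite mule_ge0// iidV_ge0. Qed.

Let mhead k : measurable_fun setT
  (fun cz : R * Z => wg cz.2 * iidV k (cz.1 + w cz.2))%E.
Proof.
apply: emeasurable_funM; first exact: (measurableT_comp mwg).
apply: (measurableT_comp (measurable_iidV k)); apply: measurable_funD => //.
exact: (measurableT_comp mw).
Qed.

Lemma measurable_headE k : measurable_fun setT (headE k).
Proof.
apply: (measurable_pairE pi Q p pd _ (mhead k)).
by move=> z; rewrite mule_ge0// iidV_ge0.
Qed.

(* Tonelli exchanges the distinguished sample with the one being averaged. *)
Lemma pairE_headE k c :
  pairE pi Q p (fun z => headE k (c + w z)) = headE k.+1 c.
Proof.
rewrite /headE (pairE_swap pi Q p pd
  (fun zu : Z * Z => wg zu.2 * iidV k (c + w zu.1 + w zu.2))%E); first last.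
- by move=> zu; rewrite mule_ge0// iidV_ge0.
- apply: emeasurable_funM; first exact: (measurableT_comp mwg).
  apply: (measurableT_comp (measurable_iidV k)); apply: measurable_funD.
    by apply: measurable_funD => //; exact: (measurableT_comp mw).
  exact: (measurableT_comp mw).
apply: eq_pairE => u.
rewrite iidVS -(pairEZl pi Q p pd _ _ (measurable_iidV_shift k _)); first last.
- exact: wg_ge0.
- by move=> z; exact: iidV_ge0.
by apply: eq_pairE => z; rewrite addrAC.
Qed.

(** The offset [c] and the accumulator [a] hold what earlier draws put into denominator and
    numerator, which makes the induction close: a first draw [z] turns them into [c + w z] and
    [a + wg z]. Its own term [wg z] gives one [headE], the later draws give the others. *)
Lemma iidE_ratio k (c : R) (a : \bar R) : (0 <= a)%E ->
  iid k (fun s => (`|c + \sum_(z <- s) w z|^-1)%:E * (a + \sum_(z <- s) wg z))%E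
  = (a * iidV k c + k%:R%:E * headE k.-1 c)%E.
Proof.
elim: k c a => [|k IH] c a a0.
  by rewrite /iidV /iid /= !big_nil addr0 mul0e !adde0 muleC.
rewrite iidES (eq_pairE _ _ _ _ (fun z =>
    (a * iidV k (c + w z) + wg z * iidV k (c + w z)) +
    k%:R%:E * headE k.-1 (c + w z))%E); last first.
  move=> z; rewrite -ge0_muleDl// -IH; last by rewrite adde_ge0.
  by apply: eq_iidE => s _; rewrite !big_cons addrA addeA.
have mV := measurable_iidV_shift k c.
have V0 z : (0 <= iidV k (c + w z))%E by exact: iidV_ge0.
have mH : measurable_fun setT (fun z => headE k.-1 (c + w z)).
  by apply: (measurableT_comp (measurable_headE _)); exact: measurable_funD.
have H0 z : (0 <= headE k.-1 (c + w z))%E by exact: headE_ge0.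
have mVa : measurable_fun setT (fun z => a * iidV k (c + w z))%E.
  exact: measurable_funeM.
have mVw : measurable_fun setT (fun z => wg z * iidV k (c + w z))%E.
  exact: emeasurable_funM.
have mHk : measurable_fun setT (fun z => k%:R%:E * headE k.-1 (c + w z))%E.
  exact: measurable_funeM.
have Va0 z : (0 <= a * iidV k (c + w z))%E by exact: mule_ge0.
have Vw0 z : (0 <= wg z * iidV k (c + w z))%E by exact: mule_ge0.
have Hk0 z : (0 <= k%:R%:E * headE k.-1 (c + w z))%E.
  by rewrite mule_ge0// lee_fin.
rewrite (pairED pi Q p pd _ _ (emeasurable_funD mVa mVw) mHk _ Hk0); last first.
  by move=> z; exact: adde_ge0.
rewrite (pairED pi Q p pd _ _ mVa mVw Va0 Vw0) (pairEZl pi Q p pd _ _ mV V0 a0).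
rewrite -iidVS -/(headE k c) -addeA; congr (_ + _)%E.
rewrite (pairEZl pi Q p pd _ _ mH H0); last by rewrite lee_fin.
(* For [k = 0] the truncated [k.-1] is harmless, its coefficient being [0]; otherwise [pairE_headE]
   makes the remaining term a multiple of the same [headE]. *)
case: k {IH mV V0 mH H0 mVa mVw mHk Va0 Vw0 Hk0} => [|k] /=.
  by rewrite mul0e adde0 mul1e.
rewrite pairE_headE -[in RHS]natr1 EFinD ge0_muleDl ?lee_fin//.
by rewrite mul1e addeC.
Qed.

(** This is [iidE_ratio] with offset and accumulator [0]; the absolute value drops out because the
    weights have a nonnegative sum. *)
Lemma curEE K : curE pi Q r eps p K g = (K%:R%:E * headE K.-1 0)%E.
Proof.
have := iidE_ratio K 0 0%E (lexx _); rewrite mul0e add0e => <-.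
apply: eq_iidE => s _; rewrite add0r add0e ge0_sume_distrr//.
by apply: eq_bigr => z _; rewrite /wg muleA -EFinM ger0_norm// mulrC.
Qed.

End Ratio.

(** * The choice kernel and the density of the curated sample *)

Section ChoiceKernel.
Context (K : nat).
Hypothesis K0 : (0 < K)%N.

Let H := HK pi Q r eps p K.

(** The probability that the pair [z] is chosen against [K.-1] i.i.d. competitors; [HK] is [K] times
    its noise average. *)
Let J (z : Z) : \bar R := ((w z)%:E * iidV K.-1 (w z))%E.

Let J0 z : (0 <= J z)%E.
Proof. by rewrite mule_ge0 ?lee_fin// iidV_ge0. Qed.

Let mJ : measurable_fun setT J.
Proof.
apply: emeasurable_funM; first exact/measurable_EFinP.
exact: (measurableT_comp (measurable_iidV _)).
Qed.

Let J1 z : (J z <= 1)%E.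
Proof.
apply: (@le_trans _ _ ((w z)%:E * (w z)^-1%:E)%E).
  by rewrite lee_wpmul2l ?lee_fin// iidV_le.
by rewrite -EFinM mulfV// gt_eqF.
Qed.

Let mJx x : measurable_fun setT (fun n => J (x, n)).
Proof. exact: (measurableT_comp mJ (pair1_measurable x)). Qed.

Let IJ0 x : (0 <= \int[Q]_n J (x, n))%E.
Proof. exact: integral_ge0. Qed.

Let IJ1 x : (\int[Q]_n J (x, n) <= 1)%E.
Proof.
apply: (@le_trans _ _ (\int[Q]_n 1)%E); first exact: ge0_le_integral.
by rewrite integral_cst//= probability_setT mule1.
Qed.

Let mIJ : measurable_fun setT (fun x => \int[Q]_n J (x, n))%E.
Proof. exact: (measurable_fun_fubini_tonelli_F (m2 := Q) J mJ J0). Qed.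

Let HE_ x : (\int[Q]_n0 iid K.-1 (fun s =>
     (K%:R * plw r eps n0 x /
      (plw r eps n0 x + \sum_(z <- s) plw r eps z.2 z.1))%:E)
  = K%:R%:E * \int[Q]_n J (x, n))%E.
Proof.
rewrite -ge0_integralZl ?lee_fin//; apply: eq_integral => n _.
rewrite (iidVZl K.-1 (K%:R * w (x, n)) (w (x, n))) ?mulr_ge0//.
by rewrite EFinM -muleA.
Qed.

(** The average of [J] lies between 0 and 1, so the [fine] in [HK] acts on a finite value and loses
    nothing. *)
Lemma HKE x : (H x)%:E = (K%:R%:E * \int[Q]_n J (x, n))%E.
Proof.
rewrite /H /HK HE_ fineK// ge0_fin_numE ?mule_ge0 ?lee_fin//.
rewrite (@le_lt_trans _ _ K%:R%:E)// ?ltry//.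
by rewrite -[leRHS]mule1 lee_wpmul2l ?lee_fin.
Qed.

Lemma HK_ge0 x : 0 <= H x.
Proof. by rewrite -lee_fin HKE mule_ge0 ?lee_fin. Qed.

Lemma HK_le x : H x <= K%:R.
Proof. by rewrite -lee_fin HKE -[leRHS]mule1 lee_wpmul2l ?lee_fin. Qed.

Lemma measurable_HK : measurable_fun setT H.
Proof.
apply/measurable_EFinP.
rewrite (_ : EFin \o H = fun x => K%:R%:E * \int[Q]_n J (x, n))%E.
  exact: measurable_funeM.
by apply/funext => x; rewrite /= HKE.
Qed.

(** For fixed [x] the factor [g x] leaves the noise integral in [headE], and the average of [J]
    remains. Thus the curated sample has density [p * H]. *)
Lemma curE_HK (g : T -> \bar R) : measurable_fun setT g ->
  (forall x, 0 <= g x)%E ->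
  curE pi Q r eps p K g = (\int[pi]_x ((p x)%:E * g x * (H x)%:E))%E.
Proof.
move=> mg g0; rewrite curEE// /headE /pairE -ge0_integralZl//; last 2 first.
- apply: emeasurable_funM; first exact/measurable_EFinP.
  apply: (measurable_fun_fubini_tonelli_F (m2 := Q)
    (fun z : Z => (w z)%:E * g z.1 * iidV K.-1 (0 + w z))%E).
    apply: emeasurable_funM; last exact: measurable_iidV_shift.
    apply: emeasurable_funM; first exact/measurable_EFinP.
    exact: (measurableT_comp mg).
  by move=> z; rewrite !mule_ge0 ?lee_fin// iidV_ge0.
- move=> x _; rewrite mule_ge0 ?lee_fin//; apply: integral_ge0 => n _.
  by rewrite !mule_ge0 ?lee_fin// iidV_ge0.
apply: eq_integral => x _; rewrite HKE.
rewrite (_ : \int[Q]_n _ = g x * \int[Q]_n J (x, n))%E; last first.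
  rewrite -ge0_integralZl//; apply: eq_integral => n _.
  by rewrite add0r /J /= muleA (muleC (g x)).
by rewrite muleCA !muleA; congr (_ * _)%E; rewrite muleAC.
Qed.

(** The selection probabilities add up to 1 in every realization, before any averaging. *)
Lemma curE_cst1 : curE pi Q r eps p K (fun=> 1%E) = 1%E.
Proof.
rewrite /curE -[RHS](iidE_cst K 1); apply: eq_iidE => s sK.
rewrite -ge0_sume_distrl; last first.
  by move=> z _; rewrite lee_fin divr_ge0// ltW// expR_gt0.
rewrite mule1 sumEFin -mulr_suml mulfV// gt_eqF//.
(* The total weight is positive as soon as the list is nonempty, which [0 < K] ensures. *)
case: s sK => [K0'|z s _]; first by move: K0; rewrite -K0'.
by rewrite big_cons ltr_pwDl// expR_gt0.
Qed.

Lemma density_HK : is_density pi (fun x => p x * H x).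
Proof.
split.
- by apply: measurable_funM => //; exact: measurable_HK.
- by move=> x; rewrite mulr_ge0// HK_ge0.
- rewrite -curE_cst1 curE_HK//.
  by apply: eq_integral => x _; rewrite mule1 EFinM.
Qed.

End ChoiceKernel.
End Curation.

(** * Gibbs' inequality and its equality case *)

Section Gibbs.
Context {R : realType}.

(** The strict inequality [1 + y < expR y] at [y = ln q - ln a], multiplied by [a]. *)
Lemma xlog_lt (a q : R) : 0 < a -> 0 < q -> q != a ->
  a * ln q < a * ln a + q - a.
Proof.
move=> a0 q0 qa.
have y0 : ln q - ln a != 0.
  by rewrite subr_eq0; apply: contra qa => /eqP /ln_inj ->.
have := expR_gt1Dx y0; rewrite expRB !lnK ?posrE// ltr_pdivlMr//.
by rewrite mulrDl mulrBl mul1r (mulrC (ln q)) (mulrC (ln a)); lra.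
Qed.

(** At [a = 0] the conventions that zero times [-oo] is zero and that [ln] is real-valued make both
    sides vanish. *)
Lemma xelog_self (a : R) : 0 <= a -> (a%:E * elog a)%E = (a * ln a)%:E.
Proof.
rewrite le_eqVlt => /predU1P[<-|a0]; first by rewrite mul0e mul0r.
by rewrite /elog a0 EFinM.
Qed.

Lemma xelog_le (a q : R) : 0 <= a -> 0 <= q ->
  (a%:E * elog q <= (a * ln a + q - a)%:E)%E.
Proof.
rewrite le_eqVlt => /predU1P[<-|a0] q0.
  by rewrite mul0e mul0r add0r subr0 lee_fin.
rewrite /elog; case: ifPn => [qp|_]; last first.
  by rewrite gt0_muleNy ?lte_fin// leNye.
rewrite -EFinM lee_fin; have [->|qa] := eqVneq q a; first by lra.
by rewrite ltW// xlog_lt.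
Qed.

(** Keeping the term [q - a] pins [q] down even where [a] vanishes: there equality reads [0 = q]. *)
Lemma xelog_eq (a q : R) : 0 <= a -> 0 <= q ->
  (a%:E * elog q)%E = (a * ln a + q - a)%:E -> q = a.
Proof.
rewrite le_eqVlt => /predU1P[<-|a0] q0.
  by rewrite mul0e mul0r add0r subr0 => -[].
rewrite /elog; case: ifPn => [qp|_]; last by rewrite gt0_muleNy ?lte_fin.
rewrite -EFinM => -[]; have [//|qa] := eqVneq q a.
by have := xlog_lt a q a0 qp qa; lra.
Qed.

Lemma measurable_elog {d} {T : measurableType d} (q : T -> R) :
  measurable_fun setT q -> measurable_fun setT (fun x => elog (q x)).
Proof.
move=> mq; apply: measurable_fun_ifT.
- exact: measurable_fun_ltr.
- by apply/measurable_EFinP; apply: (measurableT_comp (@measurable_ln R)).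
- exact: measurable_cst.
Qed.

Context {d : measure_display} {T : measurableType d}.
Context (mu : {measure set T -> \bar R}) (a : T -> R).
Hypothesis da : is_density mu a.
Hypothesis ea : (\int[mu]_x (a x * `|ln (a x)|)%:E < +oo)%E.

Let ma : measurable_fun setT a. Proof. by case: da. Qed.
Let a0 x : 0 <= a x. Proof. by case: da. Qed.

(** The sign is opposite to the usual one, so this quantity is to be maximized. *)
Definition cross_entropy (q : T -> R) : \bar R :=
  (\int[mu]_x ((a x)%:E * elog (q x)))%E.

Lemma density_integrable (q : T -> R) : is_density mu q ->
  mu.-integrable setT (EFin \o q).
Proof.
move=> [mq q0 q1]; apply/integrableP; split; first exact/measurable_EFinP.
by under eq_integral do rewrite /= ger0_norm//; rewrite q1 ltry.
Qed.

Let L x : R := a x * ln (a x).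

Let mln : measurable_fun setT L.
Proof.
apply: measurable_funM => //.
exact: (measurableT_comp (@measurable_ln R)).
Qed.

Let iln : mu.-integrable setT (EFin \o L).
Proof.
apply/integrableP; split; first exact/measurable_EFinP.
by under eq_integral do rewrite /= normrM (ger0_norm (a0 _)).
Qed.

(** The integrable majorant from Gibbs' inequality. Its integral does not depend on the density [q],
    because [q] and [a] have the same mass. *)
Let U (q : T -> R) x : R := L x + q x - a x.

Let iU q : is_density mu q -> mu.-integrable setT (EFin \o U q).
Proof.
move=> dq; rewrite (_ : EFin \o U q =
    (((EFin \o L) \+ (EFin \o q)) \- (EFin \o a))%E); last by apply/funext.
apply: integrableB => //; last exact: density_integrable.
by apply: integrableD => //; exact: density_integrable.
Qed.

Lemma cross_entropy_self :
  cross_entropy a = (\int[mu]_x (a x * ln (a x))%:E)%E.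
Proof. by apply: eq_integral => x _; rewrite xelog_self. Qed.

Let fin_self : cross_entropy a \is a fin_num.
Proof. by rewrite cross_entropy_self; exact: (integrable_fin_num _ iln). Qed.

Let intU q : is_density mu q -> (\int[mu]_x (U q x)%:E = cross_entropy a)%E.
Proof.
move=> dq; have [_ _ q1] := dq; have [_ _ a1] := da.
have iq := density_integrable q dq; have ia := density_integrable a da.
rewrite (_ : (fun x => (U q x)%:E) =
    (((EFin \o L) \+ (EFin \o q)) \- (EFin \o a))%E); last by apply/funext.
rewrite (integralB _ (integrableD _ iln iq) ia)//.
by rewrite integralD// a1 q1 cross_entropy_self addeK.
Qed.

Let mxelog (q : T -> R) : measurable_fun setT q ->
  measurable_fun setT (fun x => (a x)%:E * elog (q x))%E.
Proof.
move=> mq; apply: emeasurable_funM; first exact/measurable_EFinP.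
exact: measurable_elog.
Qed.

(** The positive part is dominated by that of [U q], hence has finite integral; an infinite negative
    part would make the value [-oo]. *)
Lemma cross_entropy_fin (q : T -> R) : is_density mu q ->
  cross_entropy q != -oo%E ->
  mu.-integrable setT (fun x => (a x)%:E * elog (q x))%E.
Proof.
move=> dq; have [mq q0 _] := dq; set f := fun x => _.
have mf : measurable_fun setT f by exact: mxelog.
have ipos : (\int[mu]_x f^\+ x < +oo)%E.
  apply: (@le_lt_trans _ _ (\int[mu]_x (EFin \o U q)^\+ x)%E); last first.
    by rewrite ltey_eq (integrable_pos_fin_num measurableT (iU _ dq)).
  apply: ge0_le_integral => //.
  - exact: measurable_funepos.
  - by apply: measurable_funepos; have /integrableP[] := iU _ dq.
  - move=> x _; rewrite !funeposE ge_max le_max; rewrite le_max lexx orbT andbT.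
    by rewrite xelog_le.
rewrite /cross_entropy integralE => fNy.
have ineg : (\int[mu]_x f^\- x < +oo)%E.
  rewrite ltey; apply: contra fNy => /eqP ->.
  by rewrite addeNy.
apply/integrableP; split => //.
rewrite (_ : (fun x => `|f x|%E) = (f^\+ \+ f^\-)%E); last first.
  by rewrite -fune_abse.
rewrite ge0_integralD//; [|exact: measurable_funepos|exact: measurable_funeneg].
by rewrite lte_add_pinfty.
Qed.

Lemma cross_entropy_le (q : T -> R) : is_density mu q ->
  (cross_entropy q <= cross_entropy a)%E.
Proof.
move=> dq; have [mq q0 _] := dq.
have [->|/(cross_entropy_fin q dq) iq] := eqVneq (cross_entropy q) -oo%E.
  exact: leNye.
rewrite -(intU q dq); apply: le_integral => //; first exact: iU.
by move=> x _; exact: xelog_le.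
Qed.

(** The nonnegative gap [V] in Gibbs' inequality has integral zero, so it vanishes almost everywhere
    and [xelog_eq] applies pointwise. *)
Lemma cross_entropy_eq (q : T -> R) : is_density mu q ->
  cross_entropy q = cross_entropy a -> {ae mu, forall x, q x = a x}.
Proof.
move=> dq qa; have [mq q0 _] := dq.
have iq : mu.-integrable setT (fun x => (a x)%:E * elog (q x))%E.
  by apply: cross_entropy_fin => //; rewrite qa; case/fin_numP: fin_self.
pose V x := ((U q x)%:E - (a x)%:E * elog (q x))%E.
have V0 x : (0 <= V x)%E by rewrite sube_ge0 ?xelog_le//= orbT.
have IV : (\int[mu]_x `|V x| = 0)%E.
  under eq_integral do rewrite gee0_abs//.
  rewrite (integralB _ (iU _ dq) iq)//.
  by rewrite intU// -/(cross_entropy q) qa subee.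
have mV : measurable_fun setT V.
  by apply: emeasurable_funB; [have /integrableP[] := iU _ dq|exact: mxelog].
have := (ae_eq_integral_abs mu measurableT mV).1 IV.
apply: filterS => x /(_ I) /= Vx; apply: xelog_eq => //.
(* A zero gap forces the logarithmic term to be finite, so the subtraction can be undone. *)
move: Vx; rewrite /V; case: (_ * _)%E => //= y.
by rewrite -EFinB => -[] /subr0_eq <-.
Qed.

End Gibbs.

(** * Propagation of finite entropy through a bounded factor *)

Section FiniteEntropy.
Context {R : realType}.

(** The two summands bound two cases: for [h >= 1], [ln h <= h <= k] gives [k * k]; for [0 < h < 1],
    [ln h^-1 <= h^-1] gives 1. *)
Lemma xabsln_le (h k : R) : 0 <= h -> h <= k -> h * `|ln h| <= 1 + k * k.
Proof.
move=> h0 hk; have [h1|h1] := leP 1 h.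
  rewrite ger0_norm ?ln_ge0//.
  have : ln h <= h by rewrite ltW// ln_sublinear// (lt_le_trans _ h1).
  by move=> lh; have := ler_pM h0 (ln_ge0 h1) hk (le_trans lh hk); lra.
apply: (@le_trans _ _ 1); last by rewrite lerDl mulr_ge0// (le_trans h0).
move: h0; rewrite le_eqVlt => /predU1P[<-|h0]; first by rewrite mul0r.
rewrite ler0_norm; last by rewrite ln_le0// ltW.
rewrite -lnV ?posrE//.
rewrite -[leRHS](mulfV (lt0r_neq0 h0)) ler_wpM2l//; first exact: ltW.
by rewrite ltW// ln_sublinear// invr_gt0.
Qed.

Lemma xabslnM_le (p h k : R) : 0 <= p -> 0 <= h -> h <= k ->
  p * h * `|ln (p * h)| <= k * (p * `|ln p|) + (1 + k * k) * p.
Proof.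
move=> p0 h0 hk; have k0 := le_trans h0 hk.
have rhs0 : 0 <= k * (p * `|ln p|) + (1 + k * k) * p.
  by rewrite addr_ge0// !mulr_ge0// addr_ge0// mulr_ge0.
have [->|pn0] := eqVneq p 0; first by rewrite !mul0r !mulr0 addr0.
have [->|hn0] := eqVneq h 0; first by rewrite !mulr0 mul0r.
rewrite lnM ?posrE ?lt0r ?pn0 ?hn0//.
apply: (@le_trans _ _ (h * (p * `|ln p|) + h * `|ln h| * p)).
  rewrite [leRHS](_ : _ = p * h * (`|ln p| + `|ln h|)); last by ring.
  by rewrite ler_wpM2l ?mulr_ge0// ler_normD.
by rewrite lerD// ler_wpM2r// ?mulr_ge0// xabsln_le.
Qed.

Context {d : measure_display} {T : measurableType d}.
Context (mu : {measure set T -> \bar R}).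

Lemma measurable_xabsln (q : T -> R) : measurable_fun setT q ->
  measurable_fun setT (fun x => (q x * `|ln (q x)|)%:E).
Proof.
move=> mq; apply/measurable_EFinP; apply: measurable_funM => //.
apply: (measurableT_comp (@normr_measurable R setT)).
exact: (measurableT_comp (@measurable_ln R)).
Qed.

Lemma finite_entropyM (p h : T -> R) (k : R) :
  is_density mu p -> (\int[mu]_x (p x * `|ln (p x)|)%:E < +oo)%E ->
  measurable_fun setT h -> (forall x, 0 <= h x) -> (forall x, h x <= k) ->
  (\int[mu]_x (p x * h x * `|ln (p x * h x)|)%:E < +oo)%E.
Proof.
move=> [mp p0 p1] ep mh h0 hk.
have [k0|k0] := leP 0 k; last first.
  have h_lt0 x : h x < 0 := le_lt_trans (hk x) k0.
  (* A negative bound [k] contradicts [0 <= h x] at every point, so the integrand is zero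
     vacuously. *)
  rewrite integral0_eq ?ltry// => x _.
  by have := h_lt0 x; rewrite ltNge h0.
have mH := measurable_xabsln _ (measurable_funM mp mh).
have mL := measurable_xabsln _ mp.
have mpE : measurable_fun setT (fun x => (p x)%:E) by exact/measurable_EFinP.
apply: (@le_lt_trans _ _ (\int[mu]_x (k%:E * (p x * `|ln (p x)|)%:E +
  (1 + k * k)%:E * (p x)%:E))%E).
  apply: ge0_le_integral => //.
  - by move=> x _; rewrite lee_fin !mulr_ge0.
  - by apply: emeasurable_funD; exact: measurable_funeM.
  - by move=> x _; rewrite -!EFinM -EFinD lee_fin xabslnM_le.
have k1 : 0 <= 1 + k * k by rewrite addr_ge0// mulr_ge0.
rewrite ge0_integralD//; first last.
- exact: measurable_funeM.
- by move=> x _; rewrite -EFinM lee_fin mulr_ge0.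
- exact: measurable_funeM.
- by move=> x _; rewrite -EFinM lee_fin !mulr_ge0.
rewrite !ge0_integralZl//; first last.
- by move=> x _; rewrite lee_fin mulr_ge0.
- by move=> x _; rewrite lee_fin.
by rewrite p1 mule1 lte_add_pinfty ?ltry// lte_mul_pinfty.
Qed.

End FiniteEntropy.

(** * The maximizer of the curation objective *)

Section Maximizer.
Context {R : realType} {d dN : measure_display}.
Context {T : measurableType d} {N : measurableType dN}.
Context (pi : {sigma_finite_measure set T -> \bar R}) (Q : probability N R).
Context (r : T -> R) (eps : N -> T -> R) (K : nat).
Hypothesis mr : measurable_fun setT r.
Hypothesis meps : measurable_fun setT (fun z : N * T => eps z.1 z.2).
Hypothesis K0 : (0 < K)%N.

(** [curE_HK] handles the positive and negative parts of the logarithm separately. The nonnegative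
    weights commute with taking these parts, and their difference is the signed integral by
    definition, infinite values included. *)
Lemma Lcur_HK (p q : T -> R) : is_density pi p -> is_density pi q ->
  Lcur pi Q r eps q p K =
  (\int[pi]_x ((p x)%:E * elog (q x) * (HK pi Q r eps p K x)%:E))%E.
Proof.
move=> dp [mq _ _]; have [mp p0 _] := dp.
have h0 := HK_ge0 pi Q r eps p mr meps dp K.
have pos_part (e : \bar R) x :
    ((p x)%:E * maxe e 0 * (HK pi Q r eps p K x)%:E =
     maxe ((p x)%:E * e * (HK pi Q r eps p K x)%:E) 0)%E.
  by rewrite maxe_pMr ?lee_fin// maxe_pMl ?lee_fin// mule0 mul0e.
have me := measurable_elog q mq.
have mpos : measurable_fun setT (fun x => maxe (elog (q x)) 0).
  exact: measurable_maxe.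
have mneg : measurable_fun setT (fun x => maxe (- elog (q x)) 0)%E.
  by apply: measurable_maxe => //; exact: measurableT_comp.
have max_ge0 (e : \bar R) : (0 <= maxe e 0)%E by rewrite le_max lexx orbT.
rewrite /Lcur !curE_HK//.
rewrite [RHS]integralE; congr (_ - _)%E; apply: eq_integral => x _.
  by rewrite funeposE pos_part.
by rewrite funenegE pos_part muleN mulNe.
Qed.

Lemma Lcur_cross_entropy (p q : T -> R) : is_density pi p -> is_density pi q ->
  Lcur pi Q r eps q p K =
  cross_entropy pi (fun x => p x * HK pi Q r eps p K x) q.
Proof.
move=> dp dq; rewrite Lcur_HK//; apply: eq_integral => x _.
by rewrite EFinM muleAC.
Qed.

Variables (p : T -> R).
Hypothesis dp : is_density pi p.
Hypothesis ep : (\int[pi]_x (p x * `|ln (p x)|)%:E < +oo)%E.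

Let pH x := p x * HK pi Q r eps p K x.

Let dpH : is_density pi pH.
Proof. exact: density_HK. Qed.

Lemma finite_entropy_HK : (\int[pi]_x (pH x * `|ln (pH x)|)%:E < +oo)%E.
Proof.
apply: (finite_entropyM pi p _ K%:R dp ep).
- exact: measurable_HK.
- exact: HK_ge0.
- exact: HK_le.
Qed.

Lemma maximizer_HK : is_maximizer pi Q r eps p K pH.
Proof.
split=> // q dq; rewrite !Lcur_cross_entropy//.
exact: cross_entropy_le finite_entropy_HK _ dq.
Qed.

Lemma maximizer_unique (q : T -> R) : is_maximizer pi Q r eps p K q ->
  {ae pi, forall x, q x = pH x}.
Proof.
move=> [dq qmax]; apply: (cross_entropy_eq pi _ dpH finite_entropy_HK q dq).
apply/eqP; rewrite eq_le (cross_entropy_le pi _ dpH finite_entropy_HK q dq)/=.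
by rewrite -!Lcur_cross_entropy// qmax.
Qed.

(** By uniqueness [q] agrees with [pH] almost everywhere, so it inherits the bound. This carries the
    entropy hypothesis to the next iterate. *)
Lemma maximizer_finite_entropy (q : T -> R) : is_maximizer pi Q r eps p K q ->
  (\int[pi]_x (q x * `|ln (q x)|)%:E < +oo)%E.
Proof.
move=> qmax; have [[mq q0 _] _] := qmax; have [mH H0 _] := dpH.
rewrite (ge0_ae_eq_integral (g := fun x => (pH x * `|ln (pH x)|)%:E)).
- exact: finite_entropy_HK.
- exact: measurableT.
- exact: measurable_xabsln.
- exact: measurable_xabsln.
- by move=> x _; rewrite lee_fin mulr_ge0.
- by move=> x _; rewrite lee_fin mulr_ge0.
- by apply: filterS (maximizer_unique q qmax) => x ->.
Qed.

End Maximizer.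

(** * The iteration *)

Lemma sigma_finite_measureP {R : realType} {d : measure_display}
    {T : measurableType d} (pi : {measure set T -> \bar R}) :
  sigma_finite setT pi ->
  exists mu : {sigma_finite_measure set T -> \bar R}, pi = mu.
Proof.
move=> sf.
pose H1 := isSFinite.Build _ _ _ _ (sfinite_measure_sigma_finite sf).
pose H2 := isSigmaFinite.Build _ _ _ _ sf.
pose mu := HB.pack_for {sigma_finite_measure set T -> \bar R}
  (Measure.sort pi) H1 H2.
by exists mu; exact: eq_measure.
Qed.

Theorem theorem1 (R : realType) (d dN : measure_display)
  (T : measurableType d) (N : measurableType dN)
  (pi : {measure set T -> \bar R}) (Q : probability N R)
  (r : T -> R) (eps : N -> T -> R) (K : nat) (p0 : T -> R) :
  sigma_finite setT pi ->
  measurable_fun setT r ->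
  measurable_fun setT (fun z : N * T => eps z.1 z.2) ->
  (2 <= K)%N ->
  is_density pi p0 ->
  (\int[pi]_x (p0 x * `|ln (p0 x)|)%:E < +oo)%E ->
  forall (p : nat -> T -> R), p 0%N = p0 ->
  forall t : nat,
    (forall s, (s < t)%N -> is_maximizer pi Q r eps (p s) K (p s.+1)) ->
    [/\ (forall q, is_density pi q ->
           Lcur pi Q r eps q (p t) K =
           (\int[pi]_x ((p t x)%:E * elog (q x) * (HK pi Q r eps (p t) K x)%:E))%E),
        is_maximizer pi Q r eps (p t) K (fun x => p t x * HK pi Q r eps (p t) K x),
        (forall q, is_maximizer pi Q r eps (p t) K q ->
           {ae pi, forall x, q x = p t x * HK pi Q r eps (p t) K x})
      & (forall s, (s < t)%N ->
           {ae pi, forall x, p s.+1 x = p s x * HK pi Q r eps (p s) K x})].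
Proof.
move=> /sigma_finite_measureP[mu ->] mr meps K2 dp0 ep0 p pE t pmax.
have K0 : (0 < K)%N by exact: ltnW.
(* The invariant of the recursion. An iterate is determined only up to a null set, so its entropy
   bound comes from almost everywhere uniqueness at the previous step. *)
have P s : (s <= t)%N -> is_density mu (p s) /\
    (\int[mu]_x (p s x * `|ln (p s x)|)%:E < +oo)%E.
  elim: s => [_|s IH st]; first by rewrite pE.
  have [ds es] := IH (ltnW st); have smax := pmax s st; split.
    by case: smax.
  exact: maximizer_finite_entropy mr meps K0 _ ds es _ smax.
have [dt et] := P t (leqnn t); split.
- by move=> q dq; exact: Lcur_HK.
- exact: maximizer_HK.
- by move=> q; exact: maximizer_unique.
- move=> s st; have [ds es] := P s (ltnW st).
  exact: maximizer_unique mr meps K0 _ ds es _ (pmax s st).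
Qed.
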